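(* Let $U$ be a quantum walk on a graph with tails $\Gamma=(V,A)$ satisfying Assumptions 1 and 2 (stated in the context), and let $\lambda\in\mathbf C/2\pi\mathbf Z$ with $\mathrm{Im}\,\lambda<0$. Then there exists a nontrivial outgoing solution $\psi\in\mathbf C^A$ to the equation $U\psi=e^{-i\lambda}\psi$ if and only if $e^{-i\lambda}$ is a resonance of $U$.
   Context: **Graph with tails.** $\Gamma=(V,A)$ is a connected infinite graph with vertex set $V$ and set $A$ of oriented edges $a=(o(a),t(a))$, with $\overline a=(t(a),o(a))\in A$ whenever $a\in A$. $V=V_{\mathsf{int}}\cup V_{\mathsf t,1}\cup\dots\cup V_{\mathsf t,N}$ and $A=A_{\mathsf{int}}\sqcup A_{\mathsf t,1}\sqcup\dots\sqcup A_{\mathsf t,N}$, $N\ge1$, where $\Gamma_{\mathsf{int}}=(V_{\mathsf{int}},A_{\mathsf{int}})$ is finite and connected, $V_{\mathsf t,j}=\{v_{j,k};k\ge 0\}$ with $v_{j,0}\in V_{\mathsf{int}}$, and $A_{\mathsf t,j}=\{a^\flat_{j,k}=(v_{j,k+1},v_{j,k});k\ge0\}\cup\{a^\sharp_{j,l}=(v_{j,l-1},v_{j,l});l\ge1\}$. Each tail is a half-line attached to $\Gamma_{\mathsf{int}}$ only at $v_{j,0}$; several tails may share the same vertex $v_{j,0}$. $A_v^\flat=\{a\in A;t(a)=v\}$, $\deg(v)=\#A_v^\flat$. **Quantum walk.** $\mathcal H=\ell^2(A)$, $S\psi(a)=\psi(\overline a)$, $C\psi(a)=\sum_{b\in A^\flat_{t(a)}}c^{t(a)}_{a,b}\psi(b)$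 with $c^v=[c^v_{a,b}]_{a,b\in A_v^\flat}$ a unitary $\deg(v)\times\deg(v)$ matrix for each $v\in V$, and $U=SC$ (acting on $\mathbf C^A$ and on $\mathcal H$). **Assumption 1.** $U\psi(a_{j,k}^\flat)=\psi(a^\flat_{j,k+1})$ and $U\psi(a^\sharp_{j,l+1})=\psi(a^\sharp_{j,l})$ for $k\ge0$, $l\ge1$, $j=1,\dots,N$ (i.e. $c^{v_{j,k}}=\begin{bmatrix}0&1\\1&0\end{bmatrix}$ for $k\ge1$). **Assumption 2.** $U$ and a reference operator $U_0$ are unitary on $\mathcal H$, both satisfy Assumption 1, and $U_0=\widetilde U_0\oplus U_{\mathsf{int}}$ on $\big(\bigoplus_j\ell^2(A_{\mathsf t,j})\big)\oplus\mathbf C^{A_{\mathsf{int}}}$ with $\widetilde U_0\psi(a^\sharp_{j,1})=\psi(a^\flat_{j,0})$ and $U_{\mathsf{int}}$ unitary on $\mathbf C^{A_{\mathsf{int}}}$; $U-U_0$ has finite rank. **Complex distortion and resonances.** For $\theta\in\mathbf C/2\pi\mathbf Z$ let $Q(\theta)$ act on $\mathbf C^A$ as multiplication by $q_\theta$, where $q_\theta(a^\flat_{j,k})=e^{i\theta k}$ ($k\ge0$), $q_\theta(a^\sharp_{j,l})=e^{-i\theta l}$ ($l\ge1$), $q_\theta=1$ on $A_{\mathsf{int}}$. $U(\theta)=Q(\theta)UQ(\theta)^{-1}$; for real $\theta$ this is unitary on $\mathcal H$ and it extends (analytically in $\theta$) to a bounded operator on $\mathcal H$ for $\mathrm{Im}\,\theta<0$.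 For $\mathrm{Im}\,\lambda>\mathrm{Im}\,\theta$, $\mathrm{Im}\,\theta<0$, $e^{-i\lambda}$ is called a *resonance* of $U$ if $e^{-i\lambda}$ is an eigenvalue of $U(\theta)$ on $\mathcal H$; this does not depend on the choice of $\theta$ with $\mathrm{Im}\,\theta<\min(0,\mathrm{Im}\,\lambda)$. **Outgoing.** A solution $\psi\in\mathbf C^A$ of $U\psi=e^{-i\lambda}\psi$ is *outgoing* if $\psi(a^\flat_{j,k})=0$ for all $k\ge0$, $j=1,\dots,N$. *)

(* Defs.v *)
From HB Require Import structures.
From mathcomp Require Import all_boot all_order all_algebra.
From mathcomp Require Import ring.
From mathcomp Require Import spectral complex.
From mathcomp Require Import all_classical all_reals all_analysis.

Set Implicit Arguments.
Unset Strict Implicit.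
Unset Printing Implicit Defensive.
Import Order.TTheory GRing.Theory Num.Theory.
Local Open Scope ring_scope.

(* [gtint] and [gadj] are V_int and A_int (a set of ordered pairs, loops not
   excluded); [groot j] is the vertex v_{j,0}.  V_int is nonempty because of
   [gtails_gt0] and [groot]. *)
Record tails_graph := TailsGraph {
  gtint : finType;
  gadj : rel gtint;
  gadj_sym : symmetric gadj;
  gadj_connected : forall x y, connect gadj x y;
  gtails : nat;
  gtails_gt0 : (0 < gtails)%N;
  groot : 'I_gtails -> gtint
}.

Section Graph.
Variable G : tails_graph.

(* [inr (j, k)] is the tail vertex v_{j,k+1}. *)
Definition vert := (gtint G + 'I_(gtails G) * nat)%type.

Definition tail_vert (j : 'I_(gtails G)) (k : nat) : vert :=
  if k is k'.+1 then inr (j, k') else inl (groot j).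

Definition int_arc := {e : gtint G * gtint G | gadj e.1 e.2}.
Definition tail_arc := ('I_(gtails G) * nat + 'I_(gtails G) * nat)%type.
Definition garc := (int_arc + tail_arc)%type.

(* [tflat j k] is a^flat_{j,k} = (v_{j,k+1}, v_{j,k}), whereas [tsharp j l] is
   a^sharp_{j,l+1} = (v_{j,l}, v_{j,l+1}): the sharp arcs are numbered from 1
   in the mathematical notation and from 0 here. *)
Definition tflat j k : tail_arc := inl (j, k).
Definition tsharp j l : tail_arc := inr (j, l).
Definition flat j k : garc := inr (tflat j k).
Definition sharp j l : garc := inr (tsharp j l).

Definition src (a : garc) : vert :=
  match a with
  | inl e => inl (val e).1
  | inr (inl (j, k)) => tail_vert j k.+1
  | inr (inr (j, l)) => tail_vert j l
  end.

Definition tgt (a : garc) : vert :=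
  match a with
  | inl e => inl (val e).2
  | inr (inl (j, k)) => tail_vert j k
  | inr (inr (j, l)) => tail_vert j l.+1
  end.

Definition int_bar (e : int_arc) : int_arc :=
  exist _ ((val e).2, (val e).1)
    (eq_ind_r is_true (valP e) (gadj_sym (val e).2 (val e).1)).

Definition bar (a : garc) : garc :=
  match a with
  | inl e => inl (int_bar e)
  | inr (inl (j, k)) => sharp j k
  | inr (inr (j, l)) => flat j l
  end.

Lemma src_bar a : src (bar a) = tgt a.
Proof. by case: a => [//|[[]|[]]]. Qed.

Lemma tgt_bar a : tgt (bar a) = src a.
Proof. by case: a => [//|[[]|[]]]. Qed.

Lemma barK : involutive bar.
Proof.
case=> [[[x y] e]|[[]|[]]] //=; congr inl; exact: val_inj.
Qed.

Lemma arc_inj a b : src a = src b -> tgt a = tgt b -> a = b.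
Proof.
case: a => [e|[[j k]|[j k]]]; case: b => [f|[[j' k']|[j' k']]] //=.
- case: e f => [[x y] e] [[x' y'] f] /= [e1] [e2]; congr inl.
  by apply: val_inj; rewrite /= e1 e2.
- by move=> [-> ->].
- case: k' => [|k'] //= [-> ->]; case: k' => //= k' [] /eqP.
  by rewrite -addn2 -[X in X == _]addn0 eqn_add2l.
- case: k => [|k] //= [-> ->]; case: k' => //= k' [] /eqP.
  by rewrite -addn2 -[X in _ == X]addn0 eqn_add2l.
- by move=> _ [-> ->].
Qed.

(* Enumeration of A_v^flat = {a | t(a) = v}. *)
Definition in_arcs (v : vert) : seq garc :=
  match v with
  | inl x => [seq inl e | e <- enum {: int_arc} & (val e).2 == x]
             ++ [seq flat j 0 | j <- enum 'I_(gtails G) & groot j == x]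
  | inr (j, k) => [:: flat j k.+1; sharp j k]
  end.

Definition deg (v : vert) : nat := size (in_arcs v).

Lemma mem_in_arcs v a : (a \in in_arcs v) = (tgt a == v).
Proof.
apply/idP/eqP; last move=> <-.
  case: v => [x|[j k]] /=.
    rewrite mem_cat => /orP[] /mapP [e]; rewrite mem_filter => /andP[/eqP ex _].
      by move=> ->; rewrite -ex.
    by move=> ->; rewrite /= ex.
  by rewrite !inE => /orP[] /eqP ->.
case: a => [e|[[j [|k]]|[j k]]] /=; rewrite ?mem_cat.
- apply/orP; left; apply/mapP; exists e => //.
  by rewrite mem_filter eqxx mem_enum.
- apply/orP; right; apply/mapP; exists j => //.
  by rewrite mem_filter eqxx mem_enum.
- by rewrite inE eqxx.
- by rewrite !inE eqxx orbT.
Qed.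

Lemma in_arcs_uniq v : uniq (in_arcs v).
Proof.
case: v => [x|[j k]] //; rewrite /in_arcs cat_uniq; apply/and3P; split.
- by rewrite map_inj_uniq; [exact/filter_uniq/enum_uniq | move=> ? ? []].
- by apply/hasPn => a /mapP [j _ ->]; apply/mapP => -[].
- by rewrite map_inj_uniq; [exact/filter_uniq/enum_uniq | move=> ? ? []].
Qed.

End Graph.

Section Ell2.
Variables (R : realType) (T : choiceType).
Local Notation C := (R[i]).

Definition sqnorm (psi : T -> C) : \bar R :=
  (\esum_(t in [set: T]) (Normc.normc (psi t) ^+ 2)%:E)%E.

Definition ell2 (psi : T -> C) : Prop := (sqnorm psi < +oo)%E.

(* An operator on the space ell2(T) is represented by a map on all functions
   [T -> C]; only its values on square-summable functions matter.  Unitary means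
   surjective linear isometry. *)
Definition unitary_op (W : (T -> C) -> T -> C) : Prop :=
  [/\ forall psi, ell2 psi -> ell2 (W psi),
      forall (x : C) psi phi, ell2 psi -> ell2 phi ->
        W (fun t => x * psi t + phi t) = (fun t => x * W psi t + W phi t),
      forall psi, ell2 psi -> sqnorm (W psi) = sqnorm psi
    & forall phi, ell2 phi -> exists2 psi, ell2 psi & W psi = phi].

Definition finite_rank (W : (T -> C) -> T -> C) : Prop :=
  exists (n : nat) (f : 'I_n -> T -> C),
    (forall i, ell2 (f i)) /\
    forall psi, ell2 psi ->
      exists x : 'I_n -> C, forall t, W psi t = \sum_(i < n) x i * f i t.

Definition ell2_eigenvalue (W : (T -> C) -> T -> C) (z : C) : Prop :=
  exists psi, [/\ ell2 psi, exists t, psi t != 0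
                & forall t, W psi t = z * psi t].

End Ell2.

Section QuantumWalk.
Variables (R : realType) (G : tails_graph).
Local Notation C := (R[i]).

(* The coin matrices: [c v a b] is c^v_{a,b}, relevant only for a and b in
   [in_arcs v]. *)
Definition coin_mx (c : vert G -> garc G -> garc G -> C) (v : vert G) :
    'M[C]_(deg v) :=
  \matrix_(i, j) c v (tnth (in_tuple (in_arcs v)) i)
                     (tnth (in_tuple (in_arcs v)) j).

Definition unitary_coins (c : vert G -> garc G -> garc G -> C) : Prop :=
  forall v, coin_mx c v \is unitarymx.

Definition shift (psi : garc G -> C) : garc G -> C := fun a => psi (bar a).

Definition coin_op (c : vert G -> garc G -> garc G -> C) (psi : garc G -> C) :
    garc G -> C :=
  fun a => \sum_(b <- in_arcs (tgt a)) c (tgt a) a b * psi b.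

Definition qwalk (c : vert G -> garc G -> garc G -> C) (psi : garc G -> C) :
    garc G -> C :=
  shift (coin_op c psi).

Definition assumption1 (W : (garc G -> C) -> garc G -> C) : Prop :=
  forall psi, ell2 psi -> forall j k,
    W psi (flat j k) = psi (flat j k.+1) /\
    W psi (sharp j k.+1) = psi (sharp j k).

(* U0 is the direct sum of [Ut] and [Uint] for the decomposition of [garc G] as
   [int_arc G + tail_arc G]. *)
Definition tails_decoupled (U0 : (garc G -> C) -> garc G -> C) : Prop :=
  exists (Ut : (tail_arc G -> C) -> tail_arc G -> C)
         (Uint : (int_arc G -> C) -> int_arc G -> C),
    [/\ forall psi, ell2 psi -> forall t,
          U0 psi (inr t) = Ut (fun s => psi (inr s)) t,
        forall psi, ell2 psi -> forall e,
          U0 psi (inl e) = Uint (fun f => psi (inl f)) e,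
        forall psi, ell2 psi -> forall j, Ut psi (tsharp j 0) = psi (tflat j 0)
      & unitary_op Uint].

Definition assumption2 (U U0 : (garc G -> C) -> garc G -> C) : Prop :=
  [/\ unitary_op U /\ unitary_op U0,
      assumption1 U /\ assumption1 U0,
      tails_decoupled U0
    & finite_rank (fun psi a => U psi a - U0 psi a)].

Definition cexp (z : C) : C :=
  ((expR (complex.Re z) * cos (complex.Im z))
   +i* (expR (complex.Re z) * sin (complex.Im z)))%C.

Lemma cexp0 : cexp 0 = 1.
Proof. by rewrite /cexp /= expR0 cos0 sin0 mulr0 mulr1. Qed.

Lemma cexpD x y : cexp (x + y) = cexp x * cexp y.
Proof.
case: x y => [a b] [a' b']; rewrite /cexp /= expRD cosD sinD.
by congr Complex; ring.
Qed.

Definition distortion_weight (theta : C) (a : garc G) : C :=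
  match a with
  | inl _ => 1
  | inr (inl (_, k)) => cexp ('i%C * theta * k%:R)
  | inr (inr (_, l)) => cexp (- 'i%C * theta * l.+1%:R)
  end.

Definition distortion (theta : C) (psi : garc G -> C) : garc G -> C :=
  fun a => distortion_weight theta a * psi a.

Definition distortion_inv (theta : C) (psi : garc G -> C) : garc G -> C :=
  fun a => (distortion_weight theta a)^-1 * psi a.

Definition distorted (U : (garc G -> C) -> garc G -> C) (theta : C)
    (psi : garc G -> C) : garc G -> C :=
  distortion theta (U (distortion_inv theta psi)).

(* e^{-i lambda} is a resonance of U.  Points of C / 2 pi Z are given by
   representatives in C; Im and e^{-i lambda} do not depend on the choice. *)
Definition resonance (U : (garc G -> C) -> garc G -> C) (lambda : C) : Prop :=
  exists theta : C,
    [/\ complex.Im theta < 0, complex.Im theta < complex.Im lambda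
      & ell2_eigenvalue (distorted U theta) (cexp (- 'i%C * lambda))].

Definition outgoing (psi : garc G -> C) : Prop :=
  forall j k, psi (flat j k) = 0.

End QuantumWalk.

(* Main.v *)
Require Import Defs.
From mathcomp Require Import all_boot all_order all_algebra.
From mathcomp Require Import ring complex.
From mathcomp Require Import all_classical all_reals all_analysis.
Import Order.TTheory GRing.Theory Num.Theory.
Local Open Scope ring_scope.

(** On a tail, an eigenfunction of U for z = exp(-i lambda) is geometric: it is
    multiplied by z at each step along the incoming (flat) arcs and by 1/z at
    each step along the outgoing (sharp) ones.  Distorted by Q(theta), its
    moduli become geometric with ratios exp(Im lambda - Im theta) > 1 and
    exp(Im theta - Im lambda) < 1.  Hence, for Im theta < Im lambda, the
    distorted eigenfunction is square summable if and only if it vanishes on all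
    flat arcs, i.e. is outgoing. *)

(** * Sums of nonnegative families over arc types *)

Section Esum.
Context {R : realType}.
Local Open Scope classical_set_scope.
Local Open Scope ereal_scope.

Lemma esum_finite_lty {T : choiceType} (A : set T) (f : T -> \bar R) :
  finite_set A -> (forall t, 0 <= f t) -> (forall t, f t < +oo) ->
  \esum_(t in A) f t < +oo.
Proof.
move=> finA f0 foo; rewrite esum_fset// fsbig_finite//=.
exact: lte_sum_pinfty.
Qed.

Lemma esum_add_type {T1 T2 : choiceType} (f : T1 + T2 -> \bar R) :
  (forall t, 0 <= f t) ->
  \esum_(t in [set: T1 + T2]) f t =
  \esum_(t in [set: T1]) f (inl t) + \esum_(t in [set: T2]) f (inr t).
Proof.
move=> f0; rewrite (esumID [set inl t | t in [set: T1]])// !setTI.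
rewrite esum_image; last by move=> ? ? _ _ [].
rewrite (_ : ~` _ = [set inr t | t in [set: T2]]); last first.
  apply/seteqP; split=> [[t|t] /= nt|_ [t _ <-] [? _]//]; last by exists t.
  by case: nt; exists t.
by rewrite esum_image// => ? ? _ _ [].
Qed.

(** Summing fibre by fibre leaves finitely many finite terms. Here [I] indexes the tails, so each
    tail can be treated alone. *)
Lemma esum_prod_finType {I : finType} {T : choiceType} (f : I * T -> \bar R) :
  (forall t, 0 <= f t) ->
  (forall i, \esum_(t in [set: T]) f (i, t) < +oo) ->
  \esum_(t in [set: I * T]) f t < +oo.
Proof.
move=> f0 foo.
rewrite (_ : [set: I * T] = [set: I] `*`` fun=> [set: T]); last first.
  by apply/seteqP; split.
rewrite (@eq_esum _ _ _ _ (fun t => f (t.1, t.2))) => [|[]//].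
rewrite -(@esum_esum _ _ _ _ _ (fun i t => f (i, t)))//; apply: esum_finite_lty => //.
  exact: finite_finset.
by move=> i; exact: esum_ge0.
Qed.

(** Every partial sum is at most [a / (1 - x)]. *)
Lemma esum_geometric_lty (a x : R) : (0 <= a)%R -> (0 < x < 1)%R ->
  \esum_(k in [set: nat]) (a * x ^+ k)%:E < +oo.
Proof.
move=> a0 /andP[x0 x1].
have ax0 k : 0 <= (a * x ^+ k)%:E by rewrite lee_fin mulr_ge0// exprn_ge0// ltW.
rewrite -nneseries_esumT// (@le_lt_trans _ _ (a * (1 - x)^-1)%:E) ?ltry//.
apply: lime_le; first exact: is_cvg_nneseries.
apply: nearW => n; rewrite sumEFin lee_fin.
by apply: geometric_le_lim => //; rewrite gtr0_norm.
Qed.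

End Esum.

(** * Criteria for square summability *)

Section Ell2.
Context {R : realType} {T : choiceType}.
Local Notation C := (R[i]).
Local Open Scope classical_set_scope.

Lemma ell2_finite_support (psi : T -> C) (s : seq T) :
  (forall t, t \notin s -> psi t = 0) -> ell2 psi.
Proof.
move=> psi0; rewrite /ell2 /sqnorm.
rewrite (_ : esum _ _ =
  \esum_(t in [set` s]) (Normc.normc (psi t) ^+ 2)%:E)%E; last first.
  rewrite [RHS]esum_mkcond; apply: eq_esum => t _.
  have [//|ts] := boolP (t \in [set` s]).
  rewrite psi0 ?Normc.normc0 ?expr0n//.
  by apply: contra ts; rewrite inE.
apply: esum_finite_lty => [|t|t]; first exact: finite_seq.
  by rewrite lee_fin sqr_ge0.
exact: ltry.
Qed.

Lemma ell2_bounded (psi : T -> C) : ell2 psi ->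
  exists M : R, forall t, Normc.normc (psi t) ^+ 2 <= M.
Proof.
move=> psi2; exists (fine (sqnorm psi)) => t.
rewrite -lee_fin fineK; last first.
  rewrite ge0_fin_numE//; apply: esum_ge0 => u _.
  by rewrite lee_fin sqr_ge0.
apply: esum_ge; exists [set t]; first by split.
by rewrite fsbig_set1.
Qed.

Lemma normcX (x : C) k : Normc.normc (x ^+ k) = Normc.normc x ^+ k.
Proof.
elim: k => [|k IHk]; first exact: Normc.normc1.
by rewrite !exprS Normc.normcM IHk.
Qed.

(** A square-summable function is bounded, whereas the moduli of [w ^+ k * x] are unbounded unless
    [x = 0]. No injectivity of [e] is required, since only boundedness enters. *)
Lemma ell2_growing_geometric (psi : T -> C) (e : nat -> T) (w x : C) :
  ell2 psi -> (forall k, psi (e k) = w ^+ k * x) -> 1 < Normc.normc w -> x = 0.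
Proof.
move=> /ell2_bounded[M psiM] psie w1; apply/eqP; apply: contraT => x0.
pose y := Normc.normc w ^+ 2; pose a := Normc.normc x ^+ 2.
have a0 : 0 < a.
  rewrite exprn_even_gt0//=; apply: contra x0 => /eqP/Normc.eq0_normc ->//.
have y1 : 1 < y by rewrite exprn_egt1.
have bernoulli k : 1 + k%:R * (y - 1) <= y ^+ k.
  elim: k => [|k IHk]; first by rewrite mul0r addr0.
  apply: (@le_trans _ _ (y * (1 + k%:R * (y - 1)))); last first.
    by rewrite exprS ler_pM2l// (lt_trans _ y1).
  rewrite -subr_ge0 (_ : _ - _ = k%:R * (y - 1) ^+ 2).
    by rewrite mulr_ge0 ?sqr_ge0.
  by rewrite -natr1; ring.
have d0 : 0 < a * (y - 1) by rewrite mulr_gt0// subr_gt0.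
(* This [k] exceeds [M / (a * (y - 1))], so by Bernoulli [a * y ^+ k] exceeds the bound [M]. *)
pose k := Num.bound `|M / (a * (y - 1))|.
have := psiM (e k); rewrite psie Normc.normcM normcX exprMn exprAC leNgt -/y -/a.
case/negP; apply: (@lt_le_trans _ _ (k%:R * (y - 1) * a)).
  by rewrite -mulrA [_ * a]mulrC -ltr_pdivrMr// (le_lt_trans (ler_norm _))// archi_boundP.
by rewrite ler_pM2r// (le_trans _ (bernoulli k))// lerDr.
Qed.

End Ell2.

(** * Modulus and powers of the complex exponential *)

Section Cexp.
Context {R : realType}.
Implicit Types z : R[i].

Lemma normc_cexp z : Normc.normc (cexp z) = expR (complex.Re z).
Proof.
rewrite /Normc.normc /= !exprMn -mulrDr cos2Dsin2 mulr1.
by rewrite sqrtr_sqr gtr0_norm// expR_gt0.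
Qed.

Lemma cexp_neq0 z : cexp z != 0.
Proof.
apply/eqP => z0; have := expR_gt0 (complex.Re z).
by rewrite -normc_cexp z0 Normc.normc0 ltxx.
Qed.

Lemma cexpM_nat z k : cexp (z * k%:R) = cexp z ^+ k.
Proof.
elim: k => [|k IHk]; first by rewrite mulr0 cexp0.
by rewrite -natr1 mulrDr mulr1 cexpD IHk exprSr.
Qed.

Lemma cexpN z : cexp (- z) = (cexp z)^-1.
Proof.
by apply: (mulfI (cexp_neq0 z)); rewrite divff ?cexp_neq0// -cexpD subrr cexp0.
Qed.

(** Combined with [normc_cexp], this gives exp(-iz) the modulus exp(Im z). *)
Lemma Re_mulNi z : complex.Re (- 'i%C * z) = complex.Im z.
Proof. by case: z => a b /=; rewrite oppr0 mul0r mulN1r sub0r opprK. Qed.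

End Cexp.

(** * Eigenfunctions along the tails and their distortion *)

Section Tails.
Context {R : realType} {G : tails_graph}.
Local Notation C := (R[i]).
Variable c : vert G -> garc G -> garc G -> C.

(* Assumption 1 only speaks of square-summable functions, but [qwalk c psi a]
   depends on finitely many values of [psi]. *)
Lemma qwalk_tails (psi : garc G -> C) (j : 'I_(gtails G)) k : assumption1 (qwalk c) ->
  qwalk c psi (flat j k) = psi (flat j k.+1) /\
  qwalk c psi (sharp j k.+1) = psi (sharp j k).
Proof.
(* After reversal, both arcs end at v_{j,k+1}, encoded as [inr (j, k)]; truncating [psi] to the arcs
   entering it changes neither value. *)
move=> h1; pose s := in_arcs (inr (j, k) : vert G).
pose phi a := if a \in s then psi a else 0.
have phi2 : ell2 phi.
  by apply: (ell2_finite_support _ s) => a /negbTE as_; rewrite /phi as_.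
have [] := h1 phi phi2 j k.
rewrite {2}/phi /s !inE eqxx /= => <-; rewrite {2}/phi !inE eqxx orbT => <-.
by split; apply: eq_big_seq => b bs; rewrite /phi /s bs.
Qed.

Lemma distortion_weight_neq0 (theta : C) (a : garc G) :
  distortion_weight theta a != 0.
Proof. by case: a => [e|[[j k]|[j k]]] /=; rewrite ?oner_neq0 ?cexp_neq0. Qed.

Lemma distortionK (theta : C) :
  cancel (@distortion R G theta) (distortion_inv theta).
Proof.
move=> psi; apply/funext => a.
by rewrite /distortion_inv /distortion mulKf// distortion_weight_neq0.
Qed.

Lemma distortion_invK (theta : C) :
  cancel (@distortion_inv R G theta) (distortion theta).
Proof.
move=> psi; apply/funext => a.
by rewrite /distortion_inv /distortion mulVKf// distortion_weight_neq0.
Qed.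

Variables (lambda : C) (psi : garc G -> C).
Hypothesis h1 : assumption1 (qwalk c).
Hypothesis hpsi : forall a, qwalk c psi a = cexp (- 'i%C * lambda) * psi a.

Lemma eigen_flat j k :
  psi (flat j k) = cexp (- 'i%C * lambda) ^+ k * psi (flat j 0).
Proof.
elim: k => [|k IHk]; first by rewrite mul1r.
by have [<- _] := qwalk_tails psi j k h1; rewrite hpsi IHk mulrA -exprS.
Qed.

Lemma eigen_sharp j k :
  psi (sharp j k) = cexp (- 'i%C * lambda) ^- k * psi (sharp j 0).
Proof.
elim: k => [|k IHk]; first by rewrite invr1 mul1r.
apply: (mulfI (cexp_neq0 (- 'i%C * lambda))); rewrite -hpsi.
have [_ ->] := qwalk_tails psi j k h1.
by rewrite IHk exprS invfM mulrA mulVKf// cexp_neq0.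
Qed.

(** The internal arcs are finitely many, the flat arcs contribute zero, and the sharp arcs of each
    tail give a convergent geometric series. *)
Lemma outgoing_ell2 (theta : C) : complex.Im theta < complex.Im lambda ->
  outgoing psi -> ell2 (distortion theta psi).
Proof.
move=> tl out; rewrite /ell2 /sqnorm.
have sq0 a : (0 <= (Normc.normc (distortion theta psi a) ^+ 2)%:E)%E.
  by rewrite lee_fin sqr_ge0.
rewrite !esum_add_type//; apply: lte_add_pinfty; last apply: lte_add_pinfty.
- by apply: esum_finite_lty => [|//|e]; [exact: finite_finset|exact: ltry].
- rewrite esum1// => -[j k] _.
  by rewrite /distortion out mulr0 Normc.normc0 expr0n.
apply: esum_prod_finType => // j.
pose x := expR (complex.Im theta - complex.Im lambda) ^+ 2.
(* The factor exp(-i theta) is the weight of [sharp j 0], which is a^sharp_{j,1} and so has exponent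
   1. *)
pose b := Normc.normc (cexp (- 'i%C * theta) * psi (sharp j 0)) ^+ 2.
rewrite (@eq_esum _ _ _ _ (fun k => (b * x ^+ k)%:E)) => [|k _]; last first.
  rewrite /x -Re_mulNi -[complex.Im lambda]Re_mulNi -raddfB -normc_cexp.
  rewrite cexpD cexpN exprAC /b -exprMn -[_ ^+ k]normcX -Normc.normcM.
  congr (Normc.normc _ ^+ 2)%:E.
  rewrite /distortion -[inr _]/(sharp j k) eigen_sharp /= cexpM_nat.
  by rewrite exprS exprMn exprVn; ring.
apply: esum_geometric_lty; first exact: sqr_ge0.
rewrite exprn_gt0 ?expR_gt0//= expr_lt1 ?expR_ge0//.
by rewrite expR_lt1 subr_lt0.
Qed.

Lemma ell2_outgoing (theta : C) : complex.Im theta < complex.Im lambda ->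
  ell2 (distortion theta psi) -> outgoing psi.
Proof.
move=> tl psi2 j k; rewrite eigen_flat.
rewrite (ell2_growing_geometric (distortion theta psi) (flat j)
  (cexp ('i%C * theta + - 'i%C * lambda)) (psi (flat j 0))) ?mulr0// => [n|].
  by rewrite /distortion eigen_flat mulrA /= cexpM_nat -exprMn cexpD.
(* The modulus of exp(i theta - i lambda) is exp(Im lambda - Im theta), which exceeds 1. *)
by rewrite -['i%C * _]opprK -mulNr normc_cexp raddfD raddfN /= !Re_mulNi
  expR_gt1 addrC subr_gt0.
Qed.

End Tails.

Theorem proposition3p4 (R : realType) (G : tails_graph)
    (c : vert G -> garc G -> garc G -> R[i])
    (U0 : (garc G -> R[i]) -> garc G -> R[i])
    (hc : unitary_coins c)
    (h1 : assumption1 (qwalk c))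
    (h2 : assumption2 (qwalk c) U0)
    (lambda : R[i]) (hlambda : complex.Im lambda < 0) :
  (exists psi : garc G -> R[i],
     [/\ exists a, psi a != 0,
         outgoing psi
       & forall a, qwalk c psi a = cexp (- 'i%C * lambda) * psi a])
  <-> resonance (qwalk c) lambda.
Proof.
split=> [[psi [[a a0] out hpsi]]|[theta [_ tl [phi [phi2 [a a0] hphi]]]]].
  (* The choice theta = lambda - i lowers the imaginary part by 1; it is then negative because Im
     lambda is. *)
  have tl : complex.Im (lambda - 'i%C) < complex.Im lambda.
    by rewrite raddfB /= ltrBlDr ltrDl ltr01.
  exists (lambda - 'i%C); split=> //; first exact: lt_trans hlambda.
  exists (distortion (lambda - 'i%C) psi); split.
  - exact: (outgoing_ell2 c lambda).
  - by exists a; rewrite mulf_neq0// distortion_weight_neq0.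
  - by move=> b; rewrite /distorted distortionK {1}/distortion hpsi mulrCA.
(* Undoing the conjugation by Q(theta) gives a solution in C^A, with no claim that it is square
   summable. *)
have hpsi b : qwalk c (distortion_inv theta phi) b =
    cexp (- 'i%C * lambda) * distortion_inv theta phi b.
  apply: (mulfI (distortion_weight_neq0 theta b)).
  rewrite [LHS]hphi /distortion_inv mulrCA; congr (_ * _).
  by rewrite mulVKf// distortion_weight_neq0.
exists (distortion_inv theta phi); split=> //.
  by exists a; rewrite mulf_neq0// invr_eq0 distortion_weight_neq0.
by apply: (ell2_outgoing c lambda _ h1 hpsi theta); rewrite ?distortion_invK.
Qed.
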